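(* Let $G$ be a finite simple bicoloured graph and let $V(G)=V_1\cup V_2$ be a split of $G$, inducing the rooted graphs $(G_1,z_1)$ and $(G_2,z_2)$. Suppose there exist $\{i,j\}=\{1,2\}$ such that at least one of the following holds: (a) $rw(G_i)$ and $lw(G_j)$ are both pure; (b) $rb(G_i)$ and $lb(G_j)$ are both pure; (c) there is a neighbour $v$ of $z_j$ in $G_j$ such that $rc(G_i)$ and $lc_v(G_j)$ are both pure. Then $G$ is pure (i.e. its parity class $[G]$ is pure).
   Context: All graphs are finite and simple. A bicoloured graph is a simple graph each of whose vertices is coloured black or white. For a bicoloured graph $G$ and $u\in V(G)$, the local complement $Gu$ has vertex set $V(G)$, edge set $E(G)\,\triangle\,\{[x,y]: x\neq y,\ x,y\in N_G(u)\}$, and the same colouring as $G$ if $u$ is black in $G$; if $u$ is white in $G$, its colouring is obtained from that of $G$ by reversing the colours of all vertices of $N_G(u)$. For a word $s=u_1u_2\cdots u_k$ over $V(G)$, $Gs=(\cdots((Gu_1)u_2)\cdots)u_k$. The set $W^\circ(G)$ of parity words is the smallest set of words over $V(G)$ containing the empty word and such that: if $s\in W^\circ(G)$ and $u$ is white in $Gs$ then $su\in W^\circ(G)$; if $s\in W^\circ(G)$ and $u,v$ are adjacent black vertices of $Gs$ then $suvu, svuv\in W^\circ(G)$. The parity class of $G$ is $[G]=\{Gs: s\in W^\circ(G)\}$. An anticlique is a maximal independent set of vertices; a black anticlique is an anticlique all of whose vertices are black. $G$ (and $[G]$) is pure if no graph in $[G]$ has a black anticlique. A split of $G$ is a partition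 $V(G)=V_1\cup V_2$ with $|V_1|,|V_2|\ge 2$ such that every vertex of $V_2$ having a neighbour in $V_1$ is adjacent to every vertex of $V_1$ having a neighbour in $V_2$. A rooted graph $(H,z)$ is a simple graph $H$ with a vertex $z$ (the root) and a black/white colouring of $V(H)\setminus\{z\}$. The split induces the rooted graph $(G_1,z_1)$ obtained from $G$ by replacing $V_2$ by a single new vertex $z_1$ adjacent exactly to the vertices of $V_1$ having a neighbour in $V_2$ (colours on $V_1$ kept), and symmetrically $(G_2,z_2)$. For a rooted graph $(H,z)$ define the bicoloured graphs: $rw(H)$: colour $z$ white; $rb(H)$: colour $z$ black; $rc(H)$: colour $z$ white, locally complement at $z$, then recolour $z$ black; $lw(H)=H-z$; $lb(H)$: colour $z$ white, locally complement at $z$, then delete $z$; for a neighbour $v$ of $z$, $lc_v(H)$: colour $z$ black, form $H\{z,v\}$, then delete $z$, where for a black vertex $u$ adjacent to $v$, $H\{u,v\}=Hvu$ if $v$ is white and $H\{u,v\}=Hvuv$ if $v$ is black. *)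

(* Defs.v *)
From mathcomp Require Import all_boot.

Set Implicit Arguments.
Unset Strict Implicit.
Unset Printing Implicit Defensive.

Record sgraph (V : finType) := SGraph {
  adj : rel V;
  adj_sym : symmetric adj;
  adj_irr : irreflexive adj }.

(* [black G u] says that [u] is black in [G]; otherwise [u] is white. *)
Record bgraph (V : finType) := BGraph {
  bg_graph :> sgraph V;
  black : pred V }.

Section BicolouredGraphs.
Variable V : finType.
Implicit Types (G H : bgraph V) (u v : V) (s : seq V).

Definition lc_adj G u : rel V :=
  [rel x y | adj G x y (+) [&& x != y, adj G u x & adj G u y]].

Fact lc_adj_sym G u : symmetric (lc_adj G u).
Proof.
by move=> x y; rewrite /lc_adj /= (adj_sym G) eq_sym [adj G u x && _]andbC.
Qed.

Fact lc_adj_irr G u : irreflexive (lc_adj G u).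
Proof. by move=> x; rewrite /lc_adj /= adj_irr eqxx. Qed.

Definition lc_black G u : pred V :=
  fun x => if black G u then black G x else black G x (+) adj G u x.

Definition local_compl G u : bgraph V :=
  BGraph (SGraph (lc_adj_sym G u) (lc_adj_irr G u)) (lc_black G u).

Definition local_compls G s : bgraph V := foldl local_compl G s.

Inductive parity_word G : seq V -> Prop :=
| parity_nil : parity_word G [::]
| parity_white s u :
    parity_word G s -> ~~ black (local_compls G s) u ->
    parity_word G (rcons s u)
| parity_black_uvu s u v :
    parity_word G s ->
    black (local_compls G s) u -> black (local_compls G s) v ->
    adj (local_compls G s) u v ->
    parity_word G (s ++ [:: u; v; u])
| parity_black_vuv s u v :
    parity_word G s ->
    black (local_compls G s) u -> black (local_compls G s) v ->
    adj (local_compls G s) u v ->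
    parity_word G (s ++ [:: v; u; v]).

Definition parity_class G H : Prop :=
  exists2 s, parity_word G s & H = local_compls G s.

Definition independent G (A : {set V}) : bool :=
  [forall x in A, forall y in A, ~~ adj G x y].

Definition anticlique G (A : {set V}) : bool := maxset (independent G) A.

Definition black_anticlique G (A : {set V}) : bool :=
  anticlique G A && [forall x in A, black G x].

Definition pure G : Prop :=
  forall H, parity_class G H -> ~ exists A : {set V}, black_anticlique H A.

Definition recolour G u (c : bool) : bgraph V :=
  BGraph G (fun x => if x == u then c else black G x).

(* G{u,v}, used when [u] is a black vertex adjacent to [v] in [G]. *)
Definition pivot G u v : bgraph V :=
  if black G v then local_compls G [:: v; u; v] else local_compls G [:: v; u].

Definition is_split G (V1 V2 : {set V}) : Prop :=
  [/\ V1 :|: V2 = [set: V], [disjoint V1 & V2], 2 <= #|V1|, 2 <= #|V2| &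
      forall x y, x \in V1 -> y \in V2 ->
        (exists2 y', y' \in V2 & adj G x y') ->
        (exists2 x', x' \in V1 & adj G y x') ->
        adj G y x].

End BicolouredGraphs.

(* A rooted graph whose non-root vertices are the elements of [T]: the vertex
   set is [option T], the root is [None], and only [T] is coloured. *)
Record rgraph (T : finType) := RGraph {
  rg_graph :> sgraph (option T);
  rblack : pred T }.

Section RootedGraphs.
Variable T : finType.
Implicit Types (H : rgraph T) (v : T).

Definition colour_root H (c : bool) : bgraph (option T) :=
  BGraph H (fun x => if x is Some t then rblack H t else c).

Definition del_adj (G : bgraph (option T)) : rel T :=
  [rel x y | adj G (Some x) (Some y)].

Fact del_adj_sym G : symmetric (del_adj G).
Proof. by move=> x y; apply: adj_sym. Qed.

Fact del_adj_irr G : irreflexive (del_adj G).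
Proof. by move=> x; apply: adj_irr. Qed.

Definition delete_root (G : bgraph (option T)) : bgraph T :=
  BGraph (SGraph (del_adj_sym G) (del_adj_irr G)) (fun x => black G (Some x)).

Definition rw H : bgraph (option T) := colour_root H false.
Definition rb H : bgraph (option T) := colour_root H true.
Definition rc H : bgraph (option T) :=
  recolour (local_compl (colour_root H false) None) None true.

(* Defined as H - z by giving the root a colour that the deletion discards. *)
Definition lw H : bgraph T := delete_root (colour_root H false).
Definition lb H : bgraph T :=
  delete_root (local_compl (colour_root H false) None).
Definition lc H v : bgraph T :=
  delete_root (pivot (colour_root H true) None (Some v)).

End RootedGraphs.

Section SplitParts.
Variables (V : finType) (G : bgraph V) (A B : {set V}).

Definition part_adj : rel (option {x : V | x \in A}) :=
  fun x y => match x, y with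
  | Some a, Some a' => adj G (val a) (val a')
  | Some a, None | None, Some a => [exists b in B, adj G (val a) b]
  | None, None => false
  end.

Fact part_adj_sym : symmetric part_adj.
Proof. by move=> [x|] [y|] //=; apply: adj_sym. Qed.

Fact part_adj_irr : irreflexive part_adj.
Proof. by move=> [x|] //=; apply: adj_irr. Qed.

(* The rooted graph obtained from [G] by replacing [B] by a single vertex. *)
Definition split_part : rgraph {x : V | x \in A} :=
  RGraph (SGraph part_adj_sym part_adj_irr) (fun x => black G (val x)).

End SplitParts.

(* Main.v *)
(* Encode a bicoloured graph as a symmetric matrix over GF(2), with a diagonal
   entry 1 exactly at the white vertices; the moves generating the parity class
   are then principal pivots on {u} (u white) or {u, v} (u, v adjacent, black).
   For a vertex set S let L_S be the space of vectors x supported on S with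
   Mx = 0 on S.  A principal pivot on P exchanges x and Mx on P, so it carries
   L_S to the space of S + P (symmetric difference).  Pivoting S down until it
   is independent and black shows that G fails to be pure iff for some S every
   vertex w is "seen", i.e. x_w or (Mx)_w is nonzero for some x in L_S.
   For a split, the off-diagonal block is a rank-one matrix a b^T, and x in L_S
   restricts to each rooted part with root coordinates (b.x, a.x), swapped on
   the other side.  By symmetry of M the image of L_S in this plane is
   isotropic, hence contained in one of the three lines of GF(2)^2.  In each of
   (a), (b), (c), the graph r(G_i) accommodates two of these lines and l(G_j)
   the third one, so if G fails to be pure then so does one of them. *)
Require Import Defs.
From mathcomp Require Import all_boot.

Set Implicit Arguments.
Unset Strict Implicit.
Unset Printing Implicit Defensive.

Local Notation "\xor_ i F" := (\big[addb/false]_i F)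
  (at level 34, i at level 0, right associativity).
Local Notation "\xor_ ( i | P ) F" := (\big[addb/false]_(i | P) F)
  (at level 34, i at level 50, right associativity).

Lemma xor_option (T : finType) (F : option T -> bool) :
  \xor_o F o = F None (+) \xor_i F (Some i).
Proof.
rewrite (bigD1 None) //=; congr (_ (+) _).
rewrite (reindex_omap Some id) /=; last by case.
by apply: eq_bigl => i; rewrite eqxx.
Qed.

(** * Matrices over GF(2), their kernels on vertex sets, and pivots at a white vertex *)

Section BinaryMatrix.
Variable V : finType.
Implicit Types (G H : bgraph V) (u v w : V) (x : V -> bool) (S : {set V}).

Definition mat G u v : bool := adj G u v (+) ((u == v) && ~~ black G u).

Definition mulv G x w : bool := \xor_y (mat G w y && x y).

(** The space L_S, with one condition per vertex: exchanging [x] and [mulv G x] on [P] then amounts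
    to toggling membership in [S] on [P]. *)
Definition in_kernel G S x : Prop :=
  forall y, (if y \in S then mulv G x y else x y) = false.

Definition sees G S w : Prop :=
  exists2 x, in_kernel G S x & x w || mulv G x w.

Definition covers G S : Prop := forall w, sees G S w.

(* H is the principal pivot transform of G on P. *)
Definition pivoted (P : pred V) G H : Prop :=
  forall x y, mulv H (fun y => if P y then mulv G x y else x y) y =
              if P y then x y else mulv G x y.

Lemma mat_sym G u v : mat G u v = mat G v u.
Proof.
by rewrite /mat adj_sym; case: (eqVneq u v) => [->|] //; rewrite eq_sym.
Qed.

Lemma mat_diag G u : mat G u u = ~~ black G u.
Proof. by rewrite /mat adj_irr eqxx. Qed.

Lemma mat_adj G u v : u != v -> mat G u v = adj G u v.
Proof. by rewrite /mat => /negPf ->; rewrite addbF. Qed.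

Lemma eq_mulv G x x' : x =1 x' -> mulv G x =1 mulv G x'.
Proof. by move=> e w; apply: eq_bigr => y _; rewrite e. Qed.

Definition toggle (P : pred V) S : {set V} := [set y | P y (+) (y \in S)].

Lemma sees_pivoted P G H S w :
  pivoted P G H -> sees G S w -> sees H (toggle P S) w.
Proof.
move=> pGH [x kx xw]; exists (fun y => if P y then mulv G x y else x y).
  move=> y; have := kx y; rewrite pGH inE.
  by case: (P y); case: (y \in S).
by rewrite pGH; case: (P w); rewrite // orbC.
Qed.

Lemma covers_pivoted P G H S :
  pivoted P G H -> covers G S -> covers H (toggle P S).
Proof. by move=> pGH c w; apply: sees_pivoted pGH (c w). Qed.

(** This is a Schur complement: edge toggling gives the off-diagonal part of the rank-one update,
    and recolouring the neighbours of [u] gives its diagonal. *)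
Lemma mat_local_compl_white G u : ~~ black G u -> forall y z,
  mat (local_compl G u) y z =
  mat G y z (+) [&& y != u, z != u, mat G u y & mat G u z].
Proof.
move=> wu y z; rewrite /mat /= /lc_black (negPf wu) /lc_adj /=.
case: (eqVneq y z) => [->|yz] /=.
  rewrite !adj_irr ![z == u]eq_sym.
  case: (eqVneq u z) => [->|_] /=; first by rewrite adj_irr !addbF.
  by case: (black G z); case: (adj G u z).
rewrite !addbF; case: (eqVneq y u) yz => [->|yu] yz.
  by rewrite adj_irr addbF.
case: (eqVneq z u) => [->|zu]; first by rewrite adj_irr !andbF addbF.
by rewrite /= ?andbT !addbF ?andbT.
Qed.

(** The hypothesis is on matrices, not on [local_compl], because the same formula also leads from
    the local complement back to [G]. *)
Lemma pivoted_white G H u : mat G u u ->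
  (forall y z, mat H y z =
     mat G y z (+) [&& y != u, z != u, mat G u y & mat G u z]) ->
  pivoted (pred1 u) G H.
Proof.
move=> Guu HE x w; rewrite /mulv /=.
set b := \xor_(y | y != u) (mat G u y && x y).
have mu : \xor_y (mat G u y && x y) = x u (+) b by rewrite (bigD1 u) //= Guu.
rewrite (bigD1 u) //= eqxx mu.
have -> : \xor_(i | i != u)
    (mat H w i && (if i == u then \xor_y (mat G i y && x y) else x i)) =
  (\xor_(i | i != u) (mat G w i && x i)) (+) ((w != u) && mat G u w && b).
  rewrite /b (big_distrr (times := andb) (plus := addb)) -big_split /=.
  apply: eq_bigr => i /[dup] iu /negPf ->; rewrite HE iu /=.
  by case: (mat G w i); case: (w == u);
     case: (mat G u w); case: (mat G u i); case: (x i).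
rewrite HE eqxx /= !andbF addbF [\xor_y (mat G w y && x y)](bigD1 u) //=.
rewrite (mat_sym G w u).
case: (eqVneq w u) => [->|wu] /=.
  by rewrite Guu -/b; case: (x u); case: (b).
by case: (mat G u w); case: (x u); case: (b); case: (\xor_(i | i != u) _).
Qed.

Lemma white_pivoted G u : ~~ black G u ->
  pivoted (pred1 u) G (local_compl G u) /\
  pivoted (pred1 u) (local_compl G u) G.
Proof.
move=> wu; have GE := mat_local_compl_white wu.
have Guu : mat G u u by rewrite mat_diag.
split; apply: pivoted_white => // [|y z]; first by rewrite GE eqxx addbF.
by rewrite !GE eqxx /= ?andbF !addbF ?andbF addbK.
Qed.

(** * Pivots on a pair of adjacent black vertices *)

Definition swap u v w : V := if w == u then v else if w == v then u else w.

(** For adjacent black [u] and [v] the pivot block is the swap matrix, its own inverse: rows and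
    columns [u], [v] are interchanged and the remaining block receives the Schur complement
    correction. *)
Definition edge_pivot_mat G u v y z : bool :=
  mat G (swap u v y) (swap u v z) (+)
  [&& y != u, y != v, z != u, z != v &
      (mat G u y && mat G v z) (+) (mat G v y && mat G u z)].

Lemma mat_local_compl_black G u v : black G u -> black G v -> adj G u v ->
  forall y z, mat (local_compls G [:: u; v; u]) y z = edge_pivot_mat G u v y z.
Proof.
move=> bu bv uv y z.
have nuv : u != v by apply: contraTneq uv => ->; rewrite adj_irr.
have nvu : v != u by rewrite eq_sym.
have vu : adj G v u by rewrite adj_sym.
have GE a b : adj (local_compls G [:: u; v; u]) a b =
    let g a b := adj G a b (+) [&& a != b, adj G u a & adj G u b] in
    let h a b := g a b (+) [&& a != b, g v a & g v b] in
    h a b (+) [&& a != b, h u a & h u b].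
  by [].
(* Local complementation at a black vertex alters no colour, so [u] and [v] stay black throughout
   and only edges change. *)
have keep H a : black H a -> black (local_compl H a) =1 black H.
  by move=> ba c; rewrite /= /lc_black ba.
have bE a : black (local_compls G [:: u; v; u]) a = black G a.
  by rewrite /local_compls /foldl !keep.
rewrite /edge_pivot_mat /swap /mat bE {}GE /= adj_irr uv vu bu bv.
pose simp := (adj_irr, uv, vu, eqxx, negPf nuv, negPf nvu, bu, bv,
              andbF, andbT, addbF, addFb).
have [->|yu] := eqVneq y u; last have [->|yv] := eqVneq y v;
  (have [->|zu] := eqVneq z u; last have [->|zv] := eqVneq z v);
  rewrite /= ?simp //=; try (have uz := negPf zu; have vz := negPf zv;
    rewrite eq_sym in uz; rewrite eq_sym in vz; rewrite ?uz ?vz ?simp /=).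
- by case: (adj G u z); case: (adj G v z).
- by case: (adj G u z); case: (adj G v z).
- rewrite yu (negPf yu) (negPf yv) (adj_sym G y u) (adj_sym G y v).
  by case: (adj G u y); case: (adj G v y).
- rewrite yv (negPf yu) (negPf yv) (adj_sym G y u) (adj_sym G y v).
  by case: (adj G u y); case: (adj G v y).
- have [<-|_] := eqVneq y z; rewrite ?simp /=.
    by case: (black G y); case: (adj G u y); case: (adj G v y).
  by case: (adj G y z); case: (adj G u y); case: (adj G v y);
     case: (adj G u z); case: (adj G v z).
Qed.

Lemma mulv2 G u v x w : u != v ->
  mulv G x w = (mat G w u && x u) (+) ((mat G w v && x v) (+)
    \xor_(y | (y != u) && (y != v)) (mat G w y && x y)).
Proof.
by move=> uv; rewrite /mulv (bigD1 u) //= (bigD1 v) //= eq_sym.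
Qed.

Lemma pivoted_edge G H u v :
  u != v -> mat G u u = false -> mat G v v = false -> mat G u v ->
  mat H =2 edge_pivot_mat G u v -> pivoted (pred2 u v) G H.
Proof.
move=> uv Guu Gvv Guv HE x w.
pose R w := \xor_(y | (y != u) && (y != v)) (mat G w y && x y).
have mE w' : mulv G x w' =
    (mat G w' u && x u) (+) ((mat G w' v && x v) (+) R w').
  exact: mulv2.
have restE : \xor_(y | (y != u) && (y != v))
    (mat H w y && (if pred2 u v y then mulv G x y else x y)) =
  R (swap u v w) (+) ([&& w != u, w != v & mat G u w && R v]
                      (+) [&& w != u, w != v & mat G v w && R u]).
  rewrite /R !(big_distrr (times := andb) (plus := addb)) -!big_split /=.
  apply: eq_bigr => y /andP[yu yv].
  rewrite HE /edge_pivot_mat /= [in mat G _ (swap _ _ y)]/swap.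
  rewrite (negPf yu) (negPf yv) ?yu ?yv /=.
  case: (x y); last by rewrite !andbF.
  rewrite !andbT -/(swap u v w); case: (mat G (swap u v w) y); case: (w == u);
    case: (w == v) => //=; case: (mat G u w); case: (mat G v w);
    by case: (mat G u y); case: (mat G v y).
have Gvu : mat G v u by rewrite mat_sym.
have nvu : v == u = false by rewrite eq_sym (negPf uv).
rewrite (mulv2 _ _ _ uv) restE !HE /edge_pivot_mat /= !eqxx nvu !mE !Guu !Gvv Guv Gvu.
rewrite /swap !eqxx nvu /= ?andbF.
have [->|wu] := eqVneq w u.
  by rewrite /= Gvv Gvu; case: (x u); case: (x v); case: (R u); case: (R v).
have [->|wv] := eqVneq w v.
  by rewrite /= Guu Guv; case: (x u); case: (x v); case: (R u); case: (R v).
rewrite /= (mat_sym G w u) (mat_sym G w v).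
by case: (mat G u w); case: (mat G v w); case: (x u); case: (x v); case: (R u);
   case: (R v); case: (R w).
Qed.

Lemma black_pivoted G u v : black G u -> black G v -> adj G u v ->
  let H := local_compls G [:: u; v; u] in
  pivoted (pred2 u v) G H /\ pivoted (pred2 u v) H G.
Proof.
move=> bu bv uv H; have HE := mat_local_compl_black bu bv uv.
have nuv : u != v by apply: contraTneq uv => ->; rewrite adj_irr.
have Guu : mat G u u = false by rewrite mat_diag bu.
have Gvv : mat G v v = false by rewrite mat_diag bv.
have Guv : mat G u v by rewrite mat_adj.
have Gvu : mat G v u by rewrite mat_sym.
have nvu : v == u = false by rewrite eq_sym (negPf nuv).
split; apply: pivoted_edge => //.
- by rewrite HE /edge_pivot_mat /swap !eqxx Gvv.
- by rewrite HE /edge_pivot_mat /swap !eqxx nvu Guu !andbF.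
- by rewrite HE /edge_pivot_mat /swap !eqxx nvu Gvu.
(* The edge pivot formula applied twice returns [mat G]. *)
move=> y z; rewrite /edge_pivot_mat !HE /edge_pivot_mat /swap !eqxx nvu /=.
have [->|yu] := eqVneq y u; last have [->|yv] := eqVneq y v;
  (have [->|zu] := eqVneq z u; last have [->|zv] := eqVneq z v);
  rewrite /= ?eqxx ?nvu ?(negPf nuv) ?yu ?yv ?(negPf yu) ?(negPf yv)
    ?zu ?zv ?(negPf zu) ?(negPf zv) //= ?eqxx ?andbF ?addbF //.
by case: (mat G u y); case: (mat G v y); case: (mat G u z); case: (mat G v z);
   case: (mat G y z).
Qed.

(** * Black anticliques, covering sets and purity *)

Lemma mulv_pred1 G a w : mulv G (pred1 a) w = mat G w a.
Proof.
rewrite /mulv (bigD1 a) //= eqxx andbT big1 ?addbF // => y /negPf /= ->.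
by rewrite andbF.
Qed.

Lemma mulv_neq0 G x w : mulv G x w -> exists2 y, mat G w y & x y.
Proof.
move=> m; have [/existsP[y /andP[]]|/existsPn no] :=
  boolP [exists y, mat G w y && x y]; first by exists y.
by move: m; rewrite /mulv big1 // => y _; apply/negbTE.
Qed.

Lemma independentP G (A : {set V}) :
  reflect {in A &, forall a b, adj G a b = false} (independent G A).
Proof.
apply: (iffP forall_inP) => [h a b aA bA|h a aA].
  by apply/negbTE; apply: (forall_inP (h a aA)).
by apply/forall_inP => b bA; rewrite h.
Qed.

(** The matrix vanishes on [A], so the indicator of each vertex of [A] is a kernel vector. It sees
    that vertex and its neighbours; maximality gives every vertex outside [A] a neighbour in [A]. *)
Lemma black_anticlique_covers G (A : {set V}) :
  black_anticlique G A -> covers G A.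
Proof.
case/andP=> /maxsetP[/independentP indA maxA] /forall_inP blackA w.
have kerA a : a \in A -> in_kernel G A (pred1 a).
  move=> aA y; rewrite mulv_pred1; case: ifPn => [yA|yA] /=.
    by rewrite /mat indA // blackA // andbF.
  by apply: contraNF yA => /eqP ->.
have [wA|wA] := boolP (w \in A).
  by exists (pred1 w); [apply: kerA | rewrite /= eqxx].
have [/exists_inP[a aA wa]|/exists_inPn no] := boolP [exists a in A, adj G w a].
  exists (pred1 a); first exact: kerA.
  rewrite mulv_pred1 mat_adj ?wa ?orbT //.
  by apply: contraTneq wa => ->; rewrite adj_irr.
case/negP: wA; rewrite -[A](maxA (w |: A)) ?setU11 ?subsetUr //.
apply/independentP => a b; rewrite !in_setU1.
case/predU1P=> [->|aA] /predU1P[->|bA].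
- exact: adj_irr.
- exact/negbTE/no.
- by rewrite adj_sym; exact/negbTE/no.
exact: indA.
Qed.

(** A kernel vector is 0 at any [w] outside [A], so [w] can only be seen through a neighbour in [A];
    hence [A] is maximal. *)
Lemma covers_black_anticlique G (A : {set V}) :
  independent G A -> (forall a, a \in A -> black G a) -> covers G A ->
  black_anticlique G A.
Proof.
move=> indA blackA cov; apply/andP; split; last exact/forall_inP.
apply/maxsetP; split=> // B /independentP indB sAB.
apply/eqP; rewrite eqEsubset sAB andbT; apply/subsetP => w wB.
have [x kx] := cov w; apply: contraLR => wA.
have:= kx w; rewrite (negPf wA) => -> /=; apply/negP => /mulv_neq0[y wy xy].
have yA : y \in A by apply: contraTT xy => yA; have:= kx y; rewrite (negPf yA) => ->.
have wNy : w != y by apply: contraNneq wA => ->.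
by move: wy; rewrite mat_adj // indB // (subsetP sAB).
Qed.

Lemma covers_parity_class G H S :
  parity_class G H -> covers H S -> exists S', covers G S'.
Proof.
case=> s ps ->; elim: ps S => [|{}s u _ IH wu|{}s u v _ IH bu bv uv|{}s u v _ IH bu bv uv] S.
- by exists S.
- rewrite /local_compls foldl_rcons => c.
  exact: IH (covers_pivoted (white_pivoted wu).2 c).
- rewrite /local_compls foldl_cat => c.
  exact: IH (covers_pivoted (black_pivoted bu bv uv).2 c).
rewrite /local_compls foldl_cat => c; rewrite adj_sym in uv.
exact: IH (covers_pivoted (black_pivoted bv bu uv).2 c).
Qed.

Lemma pureP G : pure G <-> forall S, ~ covers G S.
Proof.
split=> [pG S cS|noG H GH [A HA]]; last first.
  by have [S] := covers_parity_class GH (black_anticlique_covers HA); apply: noG.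
(* Induction on the size of the set, generalised over the parity word: each pivot on a white vertex
   or black edge inside [S] extends the word and shrinks [S]. *)
have [n] := ubnP #|S|; have ps := parity_nil G.
have : covers (local_compls G [::]) S by [].
elim: n S [::] {cS} ps => // n IH S s ps cS /ltnSE leSn.
have shrink P : {in P, forall y, y \in S} -> (exists u, P u) ->
    #|toggle P S| < n.
  move=> sP [u Pu]; apply: leq_trans leSn; apply: proper_card.
  apply/properP; split; last by exists u; rewrite ?inE ?Pu ?sP.
  apply/subsetP => y; rewrite inE; case: (boolP (P y)) => // Py _.
  exact: sP.
have [/exists_inP[u uS wu]|/exists_inPn allb] :=
  boolP [exists u in S, ~~ black (local_compls G s) u].
  have c := covers_pivoted (white_pivoted wu).1 cS.
  apply: (IH (toggle (pred1 u) S) (rcons s u)).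
  - exact: parity_white.
  - by rewrite /local_compls foldl_rcons.
  by apply: shrink; [move=> y /eqP-> | exists u; rewrite /= eqxx].
have blackS a : a \in S -> black (local_compls G s) a.
  by move=> aS; rewrite -[black _ _]negbK allb.
have [indS|] := boolP (independent (local_compls G s) S).
  apply: (pG (local_compls G s)); first by exists s.
  by exists S; apply: covers_black_anticlique.
rewrite negb_forall_in => /exists_inP[u uS].
rewrite negb_forall_in => /exists_inP[v vS]; rewrite negbK => uv.
have c := covers_pivoted (black_pivoted (blackS u uS) (blackS v vS) uv).1 cS.
apply: (IH (toggle (pred2 u v) S) (s ++ [:: u; v; u])).
- by apply: parity_black_uvu => //; apply: blackS.
- by rewrite /local_compls foldl_cat.
by apply: shrink; [move=> y /pred2P[]-> | exists u; rewrite /= eqxx].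
Qed.

Lemma sees_pivot G u v S w : black G u -> adj G u v ->
  sees G S w -> sees (pivot G u v) (toggle (pred2 v u) S) w.
Proof.
move=> bu uv; rewrite /pivot; case: ifPn => [bv|wv].
  by rewrite adj_sym in uv; apply/sees_pivoted/(black_pivoted bv bu uv).1.
have nuv : u != v by apply: contraTneq uv => ->; rewrite adj_irr.
(* The white [v] turns its black neighbour [u] white, so this case is two white pivots in
   succession. *)
have wu : ~~ black (local_compl G v) u.
  by rewrite /= /lc_black (negPf wv) bu adj_sym uv.
move/(sees_pivoted (white_pivoted wv).1)/(sees_pivoted (white_pivoted wu).1).
congr (sees _ _ w); apply/setP => y; rewrite !inE /=.
by case: (eqVneq y u) => [->|_]; rewrite ?(negPf nuv) //= orbF.
Qed.

Lemma mulv_recolour_black G u x w :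
  mulv (recolour G u true) x w = mulv G x w (+) [&& w == u, ~~ black G u & x u].
Proof.
rewrite /mulv (bigD1 u) //= [in RHS](bigD1 u) //=.
have -> : \xor_(y | y != u) (mat (recolour G u true) w y && x y) =
          \xor_(y | y != u) (mat G w y && x y).
  apply: eq_bigr => y yu; rewrite /mat /=.
  by case: (eqVneq w y) => [->|//]; rewrite (negPf yu).
rewrite /mat /=; case: (eqVneq w u) => [->|_] /=; last by rewrite !addbF.
by rewrite adj_irr ?eqxx; case: (black G u); case: (x u); case: (\xor_(i | _) _).
Qed.

End BinaryMatrix.

(** Kernel vectors vanish at a root outside [S], so dropping that coordinate changes no product. *)
Lemma sees_delete (T : finType) (G : bgraph (option T)) (S : {set option T}) w :
  None \notin S -> sees G S (Some w) -> sees (delete_root G) (Some @^-1: S) w.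
Proof.
move=> NS [x kx xw]; have x0 : x None = false.
  by have:= kx None; rewrite (negPf NS).
have mE i : mulv (delete_root G) (x \o Some) i = mulv G x (Some i).
  by rewrite /mulv xor_option x0 andbF.
exists (x \o Some); last by rewrite mE.
by move=> i; rewrite mE inE; apply: kx.
Qed.

(** * Root coordinates of kernel vectors across a split *)

Section SplitCoordinates.
Variables (V : finType) (G : bgraph V) (A B : {set V}).
Hypothesis BE : forall y, (y \in B) = (y \notin A).

Definition attached (C : {set V}) y : bool := [exists b in C, adj G y b].

Hypothesis cutE : forall a b, a \in A -> b \in B ->
  adj G a b = attached B a && attached A b.

Definition cut_dot (C D : {set V}) (x : V -> bool) : bool :=
  \xor_(y | y \in C) (attached D y && x y).

Let part := {y : V | y \in A}.
Let s := cut_dot A B.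
Let t := cut_dot B A.

Definition extend (r : bool) (x : V -> bool) : option part -> bool :=
  fun o => if o is Some i then x (val i) else r.

Lemma mulv_split x w : w \in A ->
  mulv G x w = (\xor_(y | y \in A) (mat G w y && x y)) (+) (attached B w && t x).
Proof.
move=> wA; rewrite /mulv (bigID (mem A)) /=; congr (_ (+) _).
rewrite /t /cut_dot (big_distrr (times := andb) (plus := addb)) /=.
apply: eq_big => [y|y yA]; first by rewrite BE.
rewrite -BE in yA; rewrite andbA mat_adj ?cutE //.
by apply: contraTneq wA => ->; rewrite -BE.
Qed.

(** The root value [t x] reproduces the whole contribution of [B] to each row in [A], whatever the
    root colour [c]. *)
Lemma mulv_part c x (i : part) :
  mulv (colour_root (split_part G A B) c) (extend (t x) x) (Some i) =
  mulv G x (val i).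
Proof.
rewrite (mulv_split _ (valP i)) /mulv xor_option addbC; congr (_ (+) _).
  by rewrite (big_sub _ (fun y => mat G (val i) y && x y)).
by rewrite /mat /= addbF.
Qed.

Lemma mulv_part_root c x :
  mulv (colour_root (split_part G A B) c) (extend (t x) x) None =
  s x (+) (~~ c && t x).
Proof.
rewrite /mulv xor_option addbC mat_diag; congr (_ (+) _).
rewrite /s /cut_dot (big_sub _ (fun y => attached B y && x y)).
by apply: eq_bigr => j _; rewrite /mat /= addbF.
Qed.

(** Pairing [x'] with [mulv G x] over [A] gives 0 term by term: one factor vanishes on [S], the
    other off it. By the split this equates [s x' && t x] with [Q x x'], which is symmetric because
    [mat G] is. *)
Lemma cut_dot_isotropic S x x' : in_kernel G S x -> in_kernel G S x' ->
  s x && t x' = s x' && t x.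
Proof.
pose Q x x' := \xor_(y | y \in A) \xor_(z | z \in A) (x' y && (mat G y z && x z)).
have QE z z' : in_kernel G S z -> in_kernel G S z' -> s z' && t z = Q z z'.
  move=> kz kz'; apply/eqP; rewrite -negb_add; apply/negbT.
  have <- : \xor_(y | y \in A) (z' y && mulv G z y) = false.
    rewrite big1 // => y _; have:= kz y; have:= kz' y.
    by case: (y \in S) => [_ ->|->]; rewrite ?andbF.
  rewrite addbC /Q /s /cut_dot (big_distrl (times := andb) (plus := addb)) -big_split /=.
  apply: eq_bigr => y yA; rewrite mulv_split //.
  rewrite -(big_distrr (times := andb) (plus := addb)) /=.
  by case: (z' y); rewrite ?andbF ?andbT.
move=> kx kx'; rewrite !(QE _ _) // /Q exchange_big /=.
apply: eq_bigr => y _; apply: eq_bigr => z _.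
by rewrite mat_sym; case: (x' _); case: (x _); rewrite ?andbF ?andbT.
Qed.

Variable H : bgraph (option part).
Variable r : (V -> bool) -> bool.
Hypothesis mulH : forall x i, mulv H (extend (r x) x) (Some i) = mulv G x (val i).
Variable S : {set V}.

Definition part_set e : {set option part} :=
  [set o | if o is Some i then val i \in S else e].

Lemma in_kernel_part e x : in_kernel G S x ->
  (if e then mulv H (extend (r x) x) None else r x) = false ->
  in_kernel H (part_set e) (extend (r x) x).
Proof. by move=> kx ke [i|]; rewrite inE //= mulH; apply: kx. Qed.

Lemma sees_part e : covers G S ->
  (forall x, in_kernel G S x ->
     (if e then mulv H (extend (r x) x) None else r x) = false) ->
  forall i, sees H (part_set e) (Some i).
Proof.
move=> cS ke i; have [x kx xi] := cS (val i).
exists (extend (r x) x); first exact: in_kernel_part (ke x kx).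
by rewrite mulH.
Qed.

(* The image of the solution space in the coordinate plane of the root is
   isotropic, hence at most a line; off the diagonal line, one of the two
   choices for the root makes all solutions extend. *)
Lemma root_diagonal : pure H -> covers G S ->
  (forall x x', in_kernel G S x -> in_kernel G S x' ->
     mulv H (extend (r x) x) None && r x' = mulv H (extend (r x') x') None && r x) ->
  forall x, in_kernel G S x -> mulv H (extend (r x) x) None = r x.
Proof.
move=> /pureP pH cS iso x0 k0; apply/eqP; apply: contraT => ne.
(* Exactly one root coordinate of [x0] is 1, and isotropy makes the other one vanish for all
   solutions. Putting the root into the set exactly when [r x0] is 1 thus extends them all, and [x0]
   sees the root. *)
case: (pH (part_set (r x0))) => -[i|].
  apply: sees_part => // x kx; move: (iso x0 x k0 kx) ne.
  by case: (r x0); case: (r x); do 2 case: (mulv _ _ _).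
exists (extend (r x0) x0).
  by apply: in_kernel_part => //; move: ne; case: (r x0); case: (mulv _ _ _).
by move: ne => /=; case: (r x0); case: (mulv _ _ _).
Qed.

End SplitCoordinates.

(** * The line forced or excluded by purity of each graph derived from a part *)

Section SplitParts.
Variables (V : finType) (G : bgraph V) (A B S : {set V}).
Hypothesis BE : forall y, (y \in B) = (y \notin A).
Hypothesis cutE : forall a b, a \in A -> b \in B ->
  adj G a b = attached G B a && attached G A b.
Hypothesis cS : covers G S.

Let H := split_part G A B.
Let s := cut_dot G A B.
Let t := cut_dot G B A.

Lemma pure_rw_dot : pure (rw H) -> forall x, in_kernel G S x -> s x = false.
Proof.
move=> pH x kx; have := root_diagonal (mulv_part BE cutE false) pH cS _ kx.
rewrite mulv_part_root -/s -/t /= => e.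
have : s x (+) t x = t x; last by case: (s x); case: (t x).
apply: e => y z ky kz; have := cut_dot_isotropic BE cutE ky kz.
rewrite !mulv_part_root -/s -/t /=.
by case: (s y); case: (s z); case: (t y); case: (t z).
Qed.

Lemma pure_rb_dot : pure (rb H) -> forall x, in_kernel G S x -> s x = t x.
Proof.
move=> pH x kx; have := root_diagonal (mulv_part BE cutE true) pH cS _ kx.
rewrite mulv_part_root -/s -/t /= addbF; apply.
move=> y z ky kz; have := cut_dot_isotropic BE cutE ky kz.
by rewrite !mulv_part_root -/s -/t /= !addbF.
Qed.

Lemma pure_rc_dot : pure (rc H) -> forall x, in_kernel G S x -> t x = false.
Proof.
have [rcP _] := white_pivoted (isT : ~~ black (colour_root H false) None).
(* Pivoting at the white root exchanges its value [t x] with its product [s x (+) t x]; recolouring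
   it black then turns the new product [t x] into [s x]. *)
have rcE x o : mulv (rc H) (extend (A := A) (s x (+) t x) x) o =
    if o is Some i then mulv G x (val i) else s x.
  pose X := extend (A := A) (t x) x; rewrite mulv_recolour_black.
  have e : extend (s x (+) t x) x =1
      fun o => if pred1 None o then mulv (rw H) X o else X o.
    by case=> //=; rewrite mulv_part_root.
  rewrite (eq_mulv _ e) rcP {e}; case: o => [i|] /=.
    by rewrite addbF (mulv_part BE cutE).
  by rewrite addbC addbK.
move=> pH x kx.
have := root_diagonal (r := fun x => s x (+) t x) (fun x i => rcE x (Some i)) pH cS _ kx.
rewrite rcE => e; have : s x = s x (+) t x.
  apply: e => y z ky kz; rewrite !rcE; have := cut_dot_isotropic BE cutE ky kz.
  by rewrite -/s -/t; case: (s y); case: (s z); case: (t y); case: (t z).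
by case: (s x); case: (t x).
Qed.

Lemma lw_not_pure : pure (lw H) -> ~ forall x, in_kernel G S x -> t x = false.
Proof.
move/pureP=> pH tE; apply: pH => i; apply: sees_delete; last first.
  apply: (sees_part (mulv_part BE cutE false) (e := false) cS) => x kx.
  exact: tE.
by rewrite inE.
Qed.

(** If [s = t], the product at the white root is 0, so the root may join the set; the pivot at the
    root takes it out again, as deletion requires. *)
Lemma lb_not_pure : pure (lb H) -> ~ forall x, in_kernel G S x -> s x = t x.
Proof.
have [rwP _] := white_pivoted (isT : ~~ black (rw H) None).
move/pureP=> pH stE; apply: pH => i; apply: sees_delete; last first.
  apply: (sees_pivoted rwP).
  apply: (sees_part (mulv_part BE cutE false) (e := true) cS) => x kx.
  by rewrite mulv_part_root -/s -/t stE // addbb.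
by rewrite !inE.
Qed.

(** If [s = 0], the product at the black root is 0 and the root may join the set; the pivot on the
    root and [v] then removes it. *)
Lemma lc_not_pure v : adj H None (Some v) -> pure (lc H v) ->
  ~ forall x, in_kernel G S x -> s x = false.
Proof.
move=> zv /pureP pH sE; apply: pH => i; apply: sees_delete; last first.
  apply: sees_pivot => //.
  apply: (sees_part (mulv_part BE cutE true) (e := true) cS) => x kx.
  by rewrite mulv_part_root -/s sE.
by rewrite !inE.
Qed.

End SplitParts.

(** Passing to the other side interchanges [s] and [t], so the line forced by the first pure graph
    is the one excluded by the second. *)
Lemma split_pure (V : finType) (G : bgraph V) (A B : {set V})
    (G1 := split_part G A B) (G2 := split_part G B A) :
  is_split G A B ->
  (pure (rw G1) /\ pure (lw G2)) \/
  (pure (rb G1) /\ pure (lb G2)) \/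
  (exists2 v, adj G2 None (Some v) & pure (rc G1) /\ pure (lc G2 v)) ->
  pure G.
Proof.
case=> AB dAB _ _ cut h; apply/pureP => S cS.
have BE y : (y \in B) = (y \notin A).
  have [yA|yA] := boolP (y \in A); first by rewrite (disjointFr dAB yA).
  by have := in_setT y; rewrite -AB in_setU (negPf yA).
have AE y : (y \in A) = (y \notin B) by rewrite BE negbK.
have cutE a b : a \in A -> b \in B ->
    adj G a b = attached G B a && attached G A b.
  move=> aA bB; apply/idP/andP => [ab|[/exists_inP[b' b'B ab'] /exists_inP[a' a'A ba']]].
    split; apply/exists_inP; first by exists b.
    by exists a; rewrite // adj_sym.
  by rewrite adj_sym; apply: cut aA bB _ _; [exists b' | exists a'].
have cutE' b a : b \in B -> a \in A ->
    adj G b a = attached G A b && attached G B a.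
  by move=> bB aA; rewrite adj_sym cutE // andbC.
case: h => [[p1 p2]|[[p1 p2]|[v zv [p1 p2]]]].
- exact: (lw_not_pure AE cutE' cS p2) (pure_rw_dot BE cutE cS p1).
- apply: (lb_not_pure AE cutE' cS p2) => x kx.
  by rewrite (pure_rb_dot BE cutE cS p1 kx).
exact: (lc_not_pure AE cutE' cS zv p2) (pure_rc_dot BE cutE cS p1).
Qed.

Theorem theorem2p5p14 (V : finType) (G : bgraph V) (V1 V2 : {set V})
    (Gsplit : is_split G V1 V2)
    (G1 := split_part G V1 V2) (G2 := split_part G V2 V1)
    (Gcond :
      ((pure (rw G1) /\ pure (lw G2)) \/
       (pure (rb G1) /\ pure (lb G2)) \/
       (exists2 v, adj G2 None (Some v) & pure (rc G1) /\ pure (lc G2 v)))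
      \/
      ((pure (rw G2) /\ pure (lw G1)) \/
       (pure (rb G2) /\ pure (lb G1)) \/
       (exists2 v, adj G1 None (Some v) & pure (rc G2) /\ pure (lc G1 v)))) :
  pure G.
Proof.
case: Gcond; first exact: split_pure.
apply: split_pure; case: Gsplit => V12 dV c1 c2 cut.
split; rewrite // 1?setUC 1?disjoint_sym // => y x yB xA yE xE.
by rewrite adj_sym; apply: cut.
Qed.
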